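(* Let $B$ and $B'$ be two $0$-$1$ stationary simple Bratteli diagrams with edge sets $E$ and $E'$, and let $\{\sigma_e:e\in E\}$ and $\{\sigma'_{e'}:e'\in E'\}$ be the corresponding semibranching function systems defined on $(X_B,m)$ and $(X_{B'},m')$, with coding maps $\sigma$ and $\sigma'$, where each of $m$, $m'$ is the tail-invariant probability measure, a stationary Markov measure, or a quasi-stationary Markov measure on the respective path space. Suppose that, for an admissible map $\alpha:E\to E'$, the transformation $\overline\alpha:(X_B,m)\to(X_{B'},m')$ implements an isomorphism of the systems $\{\sigma_e:e\in E\}$ and $\{\sigma'_{\alpha(e)}:e\in E\}$ (so both systems, indexed by $E$, have the same matrix $\widetilde A=(\widetilde a_{e,f})_{e,f\in E}$, $\widetilde a_{e,f}=1\iff r(e)=s(f)$). Let $\pi$ and $\pi'_\alpha$ be the representations of $\mathcal O_{\widetilde A}$ generated by the operators $\{T_e:e\in E\}$ and $\{T'_{\alpha(e)}:e\in E\}$, where $$(T_e\psi)(x)=\chi_{R_e}(x)\,\rho_m(\sigma(x),\sigma_e)^{-1/2}\,\psi(\sigma(x)),\qquad\psi\in L^2(X_B,m),$$ $$(T'_{\alpha(e)}\xi)(x)=\chi_{R'_{\alpha(e)}}(x)\,\rho_{m'}(\sigma'(x),\sigma'_{\alpha(e)})^{-1/2}\,\xi(\sigma'(x)),\qquad\xi\in L^2(X_{B'},m').$$ Then the representations $\pi$ and $\pi'_\alpha$ of $\mathcal O_{\widetilde A}$ are unitarily equivalent, i.e. there is a unitary $W:L^2(X_{B'},m')\to L^2(X_B,m)$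 with $WT'_{\alpha(e)}=T_eW$ for all $e\in E$.
   Context: All relations between sets, maps and functions on a measure space are understood modulo sets of measure zero. $0$-$1$ stationary simple Bratteli diagram. $V$ is a finite set, $A=(a_{i,j})_{i,j\in V}$ is a primitive $0$-$1$ matrix, and $E$ is the set of edges: there is exactly one edge $e\in E$ with source $s(e)=i$ and range $r(e)=j$ if $a_{i,j}=1$, and none otherwise. The diagram $B$ has top level $V_0=\{v_0\}$, all levels $V_n$ ($n\ge1$) are copies of $V$, there is exactly one edge from $v_0$ to each vertex of $V_1$, and the edges between $V_n$ and $V_{n+1}$ ($n\ge1$) are a copy of $E$. $X_B$ is the set of infinite paths $x=(x_0,x_1,x_2,\ldots)$, $x_0$ an edge from $v_0$, $x_i\in E$ for $i\ge1$, with $r(x_i)=s(x_{i+1})$ for all $i\geq 0$; its topology is generated by the cylinder sets $[(e_0,\ldots,e_n)]=\{x:x_i=e_i,\ 0\le i\le n\}$ and $X_B$ is assumed to be a Cantor set. All measures are assumed Borel and non-atomic. Primed objects refer to $B'$. Tail-invariant measure: a measure on $X_B$ such that any two cylinder sets of the same length ending at the same vertex have equal measure (unique as a probability measure). Markov measure: given $P_0=(p^{(0)}_{v_0,e})$ indexed by edges $e$ from $v_0$ and matrices $P_n=(p^{(n)}_{v,e})_{v\in V,e\in E}$, $n\ge1$, with $p^{(n)}_{v,e}>0\iff s(e)=v$ and $\sum_{e:s(e)=v}p^{(n)}_{v,e}=1$ for all $v$ (for all $n\ge0$), the Markov measure is given by $m([(e_0,\ldots,e_n)])=p^{(0)}_{v_0,e_0}p^{(1)}_{s(e_1),e_1}\cdots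 p^{(n)}_{s(e_n),e_n}$. It is stationary if $P_n=P$ for all $n\ge1$, and quasi-stationary if $0<\prod_{i=1}^\infty p^{(i+1)}_{s(x_i),x_i}/p^{(i)}_{s(x_i),x_i}<\infty$ for every $x\in X_B$. The system on $X_B$: for $e\in E$, $D_e=\{y\in X_B:s(y_1)=r(e)\}$, $R_e=\{y\in X_B:y_1=e\}$, $\sigma_e:D_e\to R_e$, $\sigma_e(y)=(y'_0,e,y_1,y_2,\ldots)$ with $y'_0$ the edge from $v_0$ to $s(e)$; the coding map is $\sigma(x)=(z'_0,x_2,x_3,\ldots)$ with $z'_0$ the edge from $v_0$ to $s(x_2)$. For such $m$ one has $m\circ\sigma_e\ll m$ on $D_e$ (where $(m\circ\sigma_e)(C)=m(\sigma_e(C))$) and $\rho_m(x,\sigma_e):=\frac{d\,m\circ\sigma_e}{dm}(x)>0$ for a.e. $x\in D_e$. Admissible map: a bijection $\alpha:E\to E'$ such that for all $e,f\in E$: $r(e)=s(f)\iff r(\alpha(e))=s(\alpha(f))$. It generates $\overline\alpha:X_B\to X_{B'}$, $\overline\alpha(x)=(y_0,\alpha(x_1),\alpha(x_2),\ldots)$ with $y_0$ the edge of $B'$ from $v_0$ to $s(\alpha(x_1))$. ''$\overline\alpha$ implements an isomorphism of $\{\sigma_e\}$ and $\{\sigma'_{\alpha(e)}\}$'' means that for all $e\in E$, with $\varphi_e:=\overline\alpha|_{R_e}$: (a) $\varphi_e:R_e\to R'_{\alpha(e)}$ is one-to-one and onto; (b) $m'\circ\varphi_e$ is equivalent to $m|_{R_e}$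 on $R_e$; (c) $\overline\alpha$ maps $D_e$ to $D'_{\alpha(e)}$ and $\overline\alpha\circ\sigma_e(x)=\sigma'_{\alpha(e)}\circ\overline\alpha(x)$ for $x\in D_e$. Cuntz-Krieger algebra: for a $0$-$1$ matrix $A=(a_{i,j})$, $\mathcal O_A$ is the $C^*$-algebra generated by partial isometries $S_i$ with $\sum_iS_iS_i^*=1$, $S_i^*S_i=\sum_ja_{i,j}S_jS_j^*$; operators satisfying these relations determine a representation of $\mathcal O_A$ (and the displayed operators do so for $\widetilde A$). *)

(* Defs.v *)
From HB Require Import structures.
From mathcomp Require Import all_boot all_order all_algebra.
From mathcomp Require Import all_classical all_reals all_analysis.
From mathcomp Require Import measurable_realfun finmap ring_quotient complex lra.

Set Implicit Arguments.
Unset Strict Implicit.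
Unset Printing Implicit Defensive.
Import Order.TTheory GRing.Theory Num.Theory.
Import numFieldNormedType.Exports.

Local Open Scope classical_set_scope.
Local Open Scope ring_scope.

Fixpoint adj_power (V : finType) (a : rel V) (n : nat) (i j : V) : nat :=
  if n is n'.+1 then (\sum_(k : V) a i k * adj_power a n' k j)%N
  else (i == j) : nat.

Definition primitive (V : finType) (a : rel V) : Prop :=
  exists2 n, (0 < n)%N & forall i j, (0 < adj_power a n i j)%N.

(* The 0-1 matrix A is the relation [bd_adj], with entries coerced to nat. *)
Record bratteli := Bratteli {
  bd_vert :> finType;
  bd_adj : rel bd_vert;
  bd_nonempty : (0 < #|bd_vert|)%N;
  bd_primitive : primitive bd_adj }.

Definition edge (B : bratteli) := {ij : B * B | bd_adj ij.1 ij.2}.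
Definition src (B : bratteli) (e : edge B) : B := (val e).1.
Definition rng (B : bratteli) (e : edge B) : B := (val e).2.

(* There is exactly one edge from v_0 to each vertex of V_1, so such an edge is
   identified with its range: [bp_top x] is r(x_0), and [bp_edge x i] is
   x_(i+1). *)
Record bpath (B : bratteli) := BPath {
  bp_top : B;
  bp_edge : nat -> edge B;
  bp_topP : bp_top = src (bp_edge 0);
  bp_edgeP : forall i, rng (bp_edge i) = src (bp_edge i.+1) }.

Lemma bpath_eq (B : bratteli) (x y : bpath B) :
  bp_edge x = bp_edge y -> x = y.
Proof.
case: x y => [t f tP fP] [t' f' tP' fP'] /= ff'; subst f'.
have tt' : t = t' by rewrite tP tP'.
by move: tP tP'; rewrite -tt' => tP tP'; rewrite (Prop_irrelevance tP tP') (Prop_irrelevance fP fP').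
Qed.

Lemma out_edge (B : bratteli) (v : B) : exists e : edge B, src e = v.
Proof.
have [[//|n] _ /(_ v v)] := bd_primitive B.
rewrite /= lt0n sum_nat_eq0 => /forallPn[k].
rewrite negb_imply /= muln_eq0 negb_or => /andP[+ _].
rewrite eqb0 negbK => avk.
by exists (exist _ (v, k) avk).
Qed.

Lemma bpath_inhabited (B : bratteli) : exists _ : bpath B, True.
Proof.
have [v0 _] : exists v : B, v \in B by apply/card_gt0P/bd_nonempty.
have [nxt nxtP] := choice (@out_edge B).
pose f := fix f i := if i is j.+1 then nxt (rng (f j)) else nxt v0.
by exists (@BPath B v0 f (esym (nxtP _)) (fun i => esym (nxtP _))).
Qed.

HB.instance Definition _ (B : bratteli) := gen_eqMixin (bpath B).
HB.instance Definition _ (B : bratteli) := gen_choiceMixin (bpath B).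
HB.instance Definition _ (B : bratteli) :=
  isPointed.Build (bpath B) (projT1 (cid (bpath_inhabited B))).

(* [walk v es] : the finite path (e_0, e_1, ..., e_n), where r(e_0) = v and
   es = (e_1, ..., e_n), is composable; [walk_end] is the vertex it ends at. *)
Fixpoint walk (B : bratteli) (v : B) (es : seq (edge B)) : bool :=
  if es is e :: es' then (src e == v) && walk (rng e) es' else true.

Definition walk_end (B : bratteli) (v : B) (es : seq (edge B)) : B :=
  last v (map (@rng B) es).

Definition cylinder (B : bratteli) n (v : B) (es : n.-tuple (edge B)) :
    set (bpath B) :=
  [set x | bp_top x = v /\ forall i : 'I_n, bp_edge x i = tnth es i].

Definition cylinders (B : bratteli) : set (set (bpath B)) :=
  [set C | exists n (v : B) (es : n.-tuple (edge B)),
     walk v es /\ C = cylinder v es].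

HB.instance Definition _ (B : bratteli) :=
  isSubBaseTopological.Build (bpath B) (@cylinders B) id.

HB.instance Definition _ (B : bratteli) :=
  Measurable.copy (bpath B) (g_sigma_algebraType (@open (bpath B))).

Definition bp_prefix (B : bratteli) (x : bpath B) n : n.-tuple (edge B) :=
  [tuple bp_edge x i | i < n].

Lemma walk_bp_prefix (B : bratteli) (x : bpath B) n : walk (bp_top x) (bp_prefix x n).
Proof.
suff H m : walk (src (bp_edge x m)) [seq bp_edge x i | i <- iota m n].
  rewrite bp_topP; have := H 0; congr is_true; congr walk.
  by rewrite /= -val_enum_ord -map_comp.
elim: n m => //= n IH m; rewrite eqxx /=; rewrite bp_edgeP; exact: IH.
Qed.

Lemma bp_prefix_mem (B : bratteli) (x : bpath B) n :
  cylinder (bp_top x) (bp_prefix x n) x.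
Proof. by split => // i; rewrite tnth_mktuple. Qed.

Lemma cylinder_open (B : bratteli) (C : set (bpath B)) : cylinders C -> open C.
Proof.
move=> cC; exists [set C]; last by rewrite bigcup_set1.
move=> _ ->; exists [fset C]%fset; 
  first by move=> D; rewrite in_fset1 => /eqP ->; exact: mem_set.
apply/seteqP; split => [z|z Cz D]; first by apply; rewrite /= inE.
by rewrite /= inE => /eqP ->.
Qed.

Lemma open_locally_determined (B : bratteli) (U : set (bpath B)) :
  (forall x, U x -> exists n, forall y,
     (forall i, (i < n)%N -> bp_edge y i = bp_edge x i) -> U y) -> open U.
Proof.
move=> H; rewrite openE => x Ux; have [n Hn] := H x Ux.
rewrite /interior nbhsE /=; exists (cylinder (bp_top x) (bp_prefix x n)).
  split; last exact: bp_prefix_mem.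
  by apply: cylinder_open; exists n, (bp_top x), (bp_prefix x n); split => //; exact: walk_bp_prefix.
move=> y [_ yP]; apply: Hn => i iln.
by have := yP (Ordinal iln); rewrite tnth_mktuple.
Qed.

Lemma open_locally_determinedP (B : bratteli) (U : set (bpath B)) x :
  open U -> U x -> exists n, forall y,
     (forall i, (i <= n)%N -> bp_edge y i = bp_edge x i) -> U y.
Proof.
move=> [F FP <-] [C FC Cx]; have [D DP CD] := FP _ FC.
have K C' : C' \in D -> exists n, forall y,
    (forall i, (i <= n)%N -> bp_edge y i = bp_edge x i) -> C' y.
  move=> C'D; have /set_mem [n [v [es [_ E]]]] := DP _ C'D.
  have : C' x by move: Cx; rewrite -CD; apply.
  rewrite E => -[tx ex]; exists n => y Hy; split.
    by rewrite -tx !bp_topP Hy.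
  by move=> i; rewrite -ex Hy // ltnW.
have [b bP] : exists b : set (bpath B) -> nat, forall C', C' \in D -> forall y,
    (forall i, (i <= b C')%N -> bp_edge y i = bp_edge x i) -> C' y.
  suff /choice [b bP] : forall C' : set (bpath B), exists n, C' \in D -> forall y,
    (forall i, (i <= n)%N -> bp_edge y i = bp_edge x i) -> C' y by exists b.
  move=> C'; have [/K [n Hn]|] := boolP (C' \in D); last by exists 0%N.
  by exists n.
exists (\max_(C' <- enum_fset D) b C')%N => y Hy; exists C; first exact: FC.
have: C y; last by []; rewrite -CD => C' C'D.
apply: bP => // i ib; apply: Hy; apply: (leq_trans ib).
exact: (leq_bigmax_seq).
Qed.

Lemma local_measurable (B B' : bratteli) (f : bpath B -> bpath B') (k : nat) :
  (forall x y n, (forall i, (i < n + k)%N -> bp_edge y i = bp_edge x i) ->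
     forall i, (i < n)%N -> bp_edge (f y) i = bp_edge (f x) i) ->
  measurable_fun setT f.
Proof.
move=> H; apply: (@measurability _ _ _ _ _ _ (@open (bpath B'))) => //.
move=> _ [U oU <-]; rewrite setTI; apply: sub_sigma_algebra.
apply: open_locally_determined => x Ux.
have [n Hn] := open_locally_determinedP oU Ux.
exists (n.+1 + k)%N => y Hy; apply: Hn => i; exact: (H _ _ _ Hy).
Qed.

Section Systems.
Variable B : bratteli.
Implicit Types (e : edge B) (x y : bpath B).

Definition D_set e : set (bpath B) := [set y | src (bp_edge y 0) = rng e].
Definition R_set e : set (bpath B) := [set y | bp_edge y 0 = e].

Definition coding x : bpath B :=
  @BPath B (src (bp_edge x 1)) (fun i => bp_edge x i.+1) erefl
    (fun i => bp_edgeP x i.+1).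

Definition cons_edge e (f : nat -> edge B) (i : nat) : edge B :=
  if i is j.+1 then f j else e.

Lemma cons_edgeP e y : D_set e y ->
  forall i, rng (cons_edge e (bp_edge y) i) = src (cons_edge e (bp_edge y) i.+1).
Proof. by move=> De [|i] //=; exact: bp_edgeP. Qed.

(* sigma_e is only meaningful on D_e; outside D_e it is the identity. *)
Definition sigma e y : bpath B :=
  match pselect (D_set e y) with
  | left De => @BPath B (src e) (cons_edge e (bp_edge y)) erefl (cons_edgeP De)
  | right _ => y
  end.

Lemma sigmaE e y : D_set e y -> bp_edge (sigma e y) = cons_edge e (bp_edge y).
Proof. by rewrite /sigma; case: pselect. Qed.

Lemma sigmaK e y : D_set e y -> coding (sigma e y) = y.
Proof. by move=> De; apply: bpath_eq; apply/funext => i /=; rewrite sigmaE. Qed.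

Lemma coding_D e x : R_set e x -> D_set e (coding x).
Proof. by move=> <-; rewrite /D_set /= (bp_edgeP x 0). Qed.

Lemma codingK e x : R_set e x -> sigma e (coding x) = x.
Proof.
move=> Re; apply: bpath_eq; apply/funext => i.
by rewrite sigmaE; [case: i => [|i]; rewrite //= Re|exact: coding_D].
Qed.

Lemma image_sigma e (C : set (bpath B)) :
  sigma e @` (C `&` D_set e) = R_set e `&` coding @^-1` C.
Proof.
apply/seteqP; split => [_ [y [Cy De] <-]|x [Re Cx]].
  by rewrite /setI /= /R_set /preimage /= sigmaE // sigmaK.
by exists (coding x); [split => //; exact: coding_D|exact: codingK].
Qed.

Lemma measurable_edge (i : nat) e : measurable [set x : bpath B | bp_edge x i = e].
Proof.
apply: sub_sigma_algebra; apply: open_locally_determined => x xe.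
by exists i.+1 => y Hy; rewrite /= Hy.
Qed.

Lemma measurable_R_set e : measurable (R_set e).
Proof. exact: measurable_edge. Qed.

Lemma measurable_coding : measurable_fun setT coding.
Proof.
apply: (@local_measurable _ _ _ 1) => x y n H i iln /=.
by apply: H; rewrite addn1 ltnS.
Qed.

End Systems.

Section ComposedMeasure.
Context {R : realType} (B : bratteli).
Variables (m : {finite_measure set (bpath B) -> \bar R}) (e : edge B).
Local Open Scope ereal_scope.

(* m \o sigma_e, a measure on D_e, extended by 0 to X_B. *)
Definition comp_measure (C : set (bpath B)) : \bar R :=
  m (sigma e @` (C `&` D_set e)).

Lemma comp_measureE C : comp_measure C = m (R_set e `&` @coding B @^-1` C).
Proof. by rewrite /comp_measure image_sigma. Qed.

Lemma measurable_R_coding C : measurable C ->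
  measurable (R_set e `&` @coding B @^-1` C).
Proof.
move=> mC; apply: measurableI; first exact: measurable_R_set.
by rewrite -[X in measurable X]setTI; exact: measurable_coding.
Qed.

Let comp_measure0 : comp_measure set0 = 0.
Proof. by rewrite comp_measureE preimage_set0 setI0 measure0. Qed.

Let comp_measure_ge0 C : 0 <= comp_measure C.
Proof. exact: measure_ge0. Qed.

Let comp_measure_sigma_additive : semi_sigma_additive comp_measure.
Proof.
move=> F mF tF mUF.
rewrite comp_measureE preimage_bigcup setI_bigcupr.
rewrite (_ : (fun n => _) =
  fun n => \sum_(0 <= i < n) m (R_set e `&` @coding B @^-1` F i)); last first.
  by apply/funext => n; apply: eq_bigr => i _; rewrite comp_measureE.
apply: measure_semi_sigma_additive.
- by move=> i; exact: measurable_R_coding.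
- apply/trivIsetP => i j _ _ ij; rewrite setIACA setIid -preimage_setI.
  by move/trivIsetP : tF => ->//; rewrite preimage_set0 setI0.
- by apply: bigcup_measurable => i _; exact: measurable_R_coding.
Qed.

HB.instance Definition _ := isMeasure.Build _ _ _ comp_measure
  comp_measure0 comp_measure_ge0 comp_measure_sigma_additive.

Let comp_measure_fin : fin_num_fun comp_measure.
Proof.
by move=> C mC; rewrite comp_measureE fin_num_measure//; exact: measurable_R_coding.
Qed.

HB.instance Definition _ := Measure_isFinite.Build _ _ _ comp_measure
  comp_measure_fin.

(* [Radon_Nikodym] is a junk value unless m \o sigma_e << m, which holds for
   the Markov and tail-invariant measures considered here. *)
Definition rho (x : bpath B) : R :=
  fine (Radon_Nikodym (charge_of_finite_measure comp_measure) m x).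

End ComposedMeasure.

Section L2.
Context {d} {T : measurableType d} {R : realType}.
Variable mu : {measure set T -> \bar R}.

Definition sqmod (z : R[i]) : R := Normc.normc z ^+ 2.

Lemma sqmodE z : sqmod z = complex.Re z ^+ 2 + complex.Im z ^+ 2.
Proof. by case: z => a b; rewrite /sqmod /= sqr_sqrtr// addr_ge0// sqr_ge0. Qed.

Lemma sqmod_ge0 z : 0 <= sqmod z.
Proof. exact: sqr_ge0. Qed.

Lemma sqmodM z w : sqmod (z * w) = sqmod z * sqmod w.
Proof. by rewrite /sqmod Normc.normcM exprMn. Qed.

Lemma sqmodD_le z w : sqmod (z + w) <= 2 * (sqmod z + sqmod w).
Proof.
rewrite !sqmodE; case: z w => a b [a' b'] /=.
have := sqr_ge0 (a - a'); have := sqr_ge0 (b - b').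
by rewrite !sqrrB !sqrrD; lra.
Qed.

Definition square_integrable (f : T -> R[i]) : Prop :=
  [/\ measurable_fun setT (fun x => complex.Re (f x)),
      measurable_fun setT (fun x => complex.Im (f x)) &
      (\int[mu]_x (sqmod (f x))%:E < +oo)%E].

Definition l2_pred : {pred T -> R[i]} := mem [set f | square_integrable f].

Lemma measurable_sqmod (f : T -> R[i]) :
  measurable_fun setT (fun x => complex.Re (f x)) ->
  measurable_fun setT (fun x => complex.Im (f x)) ->
  measurable_fun setT (fun x => sqmod (f x)).
Proof.
move=> mr mi; under eq_fun do rewrite sqmodE.
by apply: measurable_funD; exact: measurable_funX.
Qed.

Lemma l2_submod_closed : submod_closed l2_pred.
Proof.
split.
  apply/mem_set; split; [exact: measurable_cst|exact: measurable_cst|].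
  rewrite (_ : (fun _ => _) = cst 0%E) ?integral0//.
  by apply/funext => x; rewrite sqmodE /= expr0n addr0.
move=> a f g /set_mem[rf jf If] /set_mem[rg jg Ig]; apply/mem_set.
have mr : measurable_fun setT (fun x => complex.Re ((a *: f + g) x)).
  rewrite (_ : (fun _ => _) = (fun x => complex.Re a * complex.Re (f x) -
     complex.Im a * complex.Im (f x) + complex.Re (g x))); last first.
    apply/funext => x; rewrite -[(a *: f + g) x]/(a * f x + g x).
    by move: (a) (f x) (g x) => [? ?] [? ?] [? ?].
  apply: measurable_funD => //; apply: measurable_funB.
    exact: measurable_funM.
  exact: measurable_funM.
have mi : measurable_fun setT (fun x => complex.Im ((a *: f + g) x)).
  rewrite (_ : (fun _ => _) = (fun x => complex.Re a * complex.Im (f x) +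
     complex.Im a * complex.Re (f x) + complex.Im (g x))); last first.
    apply/funext => x; rewrite -[(a *: f + g) x]/(a * f x + g x).
    by move: (a) (f x) (g x) => [? ?] [? ?] [? ?].
  apply: measurable_funD => //; apply: measurable_funD.
    exact: measurable_funM.
  exact: measurable_funM.
split => //.
have mf := measurable_sqmod rf jf.
have mg := measurable_sqmod rg jg.
apply: (@le_lt_trans _ _
  (\int[mu]_x ((2 * sqmod a)%:E * (sqmod (f x))%:E + 2%:E * (sqmod (g x))%:E))%E).
  apply: ge0_le_integral => //.
  - by move=> x _; rewrite lee_fin sqmod_ge0.
  - by apply/measurable_EFinP; exact: measurable_sqmod.
  - by apply: emeasurable_funD; apply: measurable_funeM; exact/measurable_EFinP.
  - move=> x _; rewrite -!EFinM -EFinD lee_fin.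
    apply: (le_trans (sqmodD_le _ _)).
    by rewrite [sqmod (_ *: _)]sqmodM mulrDr mulrA.
have p0 : 0 <= 2 * sqmod a by rewrite mulr_ge0// sqmod_ge0.
rewrite ge0_integralD//.
- rewrite !ge0_integralZl//; [|exact/measurable_EFinP| |exact/measurable_EFinP|].
  + by apply: lte_add_pinfty; rewrite lte_mul_pinfty// lee_fin.
  + by move=> x _; rewrite lee_fin sqmod_ge0.
  + by move=> x _; rewrite lee_fin sqmod_ge0.
- by move=> x _; rewrite -EFinM lee_fin mulr_ge0// sqmod_ge0.
- by apply: measurable_funeM; exact/measurable_EFinP.
- by move=> x _; rewrite -EFinM lee_fin mulr_ge0// sqmod_ge0.
- by apply: measurable_funeM; exact/measurable_EFinP.
Qed.

HB.instance Definition _ :=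
  GRing.isSubmodClosed.Build _ _ l2_pred l2_submod_closed.

Record l2fun := L2fun { l2val :> T -> R[i]; _ : l2val \in l2_pred }.

HB.instance Definition _ := [isSub for l2val].
HB.instance Definition _ := [Choice of l2fun by <:].
HB.instance Definition _ := [SubChoice_isSubLmodule of l2fun by <:].

Definition ae_null : {pred l2fun} := mem [set f : l2fun | {ae mu, forall x, f x = 0}].

Lemma ae_null_zmod_closed : zmod_closed ae_null.
Proof.
split; first by apply/mem_set; exact: nearW.
move=> f g /set_mem f0 /set_mem g0; apply/mem_set.
apply: filterS2 f0 g0 => x fx gx.
by rewrite -[l2val (f - g) x]/(f x - g x) fx gx subr0.
Qed.

HB.instance Definition _ :=
  GRing.isZmodClosed.Build _ ae_null ae_null_zmod_closed.

(* Elements of L^2(mu) are classes of square integrable functions modulo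
   equality almost everywhere. *)
Definition L2 : Type := Quotient.quot ae_null.
HB.instance Definition _ := GRing.Zmodule.on L2.
HB.instance Definition _ := @EqQuotient.on L2.

Definition l2class (f : l2fun) : L2 := \pi_(Quotient.quot ae_null)%qT f.
Definition l2rep (u : L2) : l2fun := repr u.

Lemma l2repK u : l2class (l2rep u) = u.
Proof. exact: reprK. Qed.

Lemma l2classP (f g : l2fun) :
  l2class f = l2class g <-> {ae mu, forall x, f x = g x}.
Proof.
have -> : (l2class f = l2class g) <-> (f - g \in ae_null).
  by rewrite Quotient.idealrBE; split => [/eqP|/eqP].
split => [/set_mem|] fg; [|apply/mem_set]; apply: filterS fg => x.
  by move=> fg0; apply/eqP; rewrite -subr_eq0; exact/eqP.
by move=> fgx; rewrite -[LHS]/(f x - g x) fgx subrr.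
Qed.

Lemma l2classD f g : l2class (f + g) = l2class f + l2class g.
Proof. exact: Quotient.pi_add. Qed.

Definition l2scale (a : R[i]) (u : L2) : L2 := l2class (a *: l2rep u).

Lemma l2classZ a f : l2class (a *: f) = l2scale a (l2class f).
Proof.
have /l2classP H := l2repK (l2class f).
apply/l2classP; apply: filterS H => x fx.
by rewrite -[LHS]/(a * f x) -fx.
Qed.

Let l2scaleA a b u : l2scale a (l2scale b u) = l2scale (a * b) u.
Proof. by rewrite -(l2repK u) -!l2classZ scalerA. Qed.

Let l2scale1 : left_id 1 l2scale.
Proof. by move=> u; rewrite -(l2repK u) -l2classZ scale1r. Qed.

Let l2scaleDr : right_distributive l2scale +%R.
Proof.
move=> a u v; rewrite -(l2repK u) -(l2repK v) -l2classD -!l2classZ.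
by rewrite scalerDr l2classD.
Qed.

Let l2scaleDl u : {morph l2scale^~ u : a b / a + b}.
Proof. by move=> a b; rewrite -(l2repK u) -!l2classZ scalerDl l2classD. Qed.

HB.instance Definition _ :=
  GRing.Zmodule_isLmodule.Build R[i] L2 l2scaleA l2scale1 l2scaleDr l2scaleDl.

(* The complex integral is computed on real and imaginary parts. *)
Definition l2inner (u v : L2) : R[i] :=
  let h x := l2rep u x * conjc (l2rep v x) in
  Complex (\int[mu]_x complex.Re (h x)) (\int[mu]_x complex.Im (h x)).

End L2.

Definition unitary_map d d' (T : measurableType d) (T' : measurableType d')
    (R : realType) (mu : {measure set T -> \bar R})
    (mu' : {measure set T' -> \bar R}) (W : {linear L2 mu -> L2 mu'}) : Prop :=
  (forall u v, l2inner (W u) (W v) = l2inner u v) /\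
  (forall v, exists u, W u = v).

Section Operators.
Context {R : realType} (B : bratteli).
Variables (m : {finite_measure set (bpath B) -> \bar R}) (e : edge B).

Definition T_fun (psi : bpath B -> R[i]) (x : bpath B) : R[i] :=
  (\1_(R_set e) x * (rho m e (coding x)) `^ (- 2^-1))%:C%C * psi (coding x).

Let nu := comp_measure m e.
Let w y := rho m e y `^ (- 2^-1).

Lemma integral_comp_measure (g : bpath B -> \bar R) :
  measurable_fun setT g -> (forall y, 0 <= g y)%E ->
  (\int[m]_(x in R_set e) g (coding x) = \int[nu]_y g y)%E.
Proof.
move=> mg g0; have mR := measurable_R_set e.
have mc := @measurable_coding B.
have mgc : measurable_fun setT (fun x => g (coding x)).
  exact: (measurableT_comp mg mc).
transitivity (\int[mrestr m mR]_(x in R_set e) g (coding x))%E.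
  apply: eq_measure_integral => A mA AR.
  by rewrite -[RHS]/(m (A `&` R_set e)) (setIidl AR).
transitivity (\int[mrestr m mR]_x g (coding x))%E.
  rewrite [RHS](@ge0_negligible_integral _ _ _ (mrestr m mR) setT (~` R_set e))//.
  - by rewrite setTD setCK.
  - exact: measurableC.
  - by apply: (etrans _ (measure0 m)); rewrite /= /mrestr setICl.
rewrite -(preimage_setT (@coding B)).
rewrite -(@ge0_integral_pushforward _ _ _ _ _ _ mc (mrestr m mR) setT g)//.
apply: eq_measure_integral => A mA _.
by rewrite -[RHS]/(comp_measure m e A) comp_measureE setIC.
Qed.

Lemma rho_not_dominated y : ~ (nu `<< m) -> rho m e y = 0.
Proof. by rewrite /rho /Radon_Nikodym; case: pselect. Qed.

Lemma measurable_rho : measurable_fun setT (rho m e).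
Proof.
have [num|/rho_not_dominated r0] := pselect (nu `<< m); last first.
  by rewrite (_ : rho m e = cst 0)//; apply/funext => y; exact: r0.
have mRN : measurable_fun setT
    (Radon_Nikodym (charge_of_finite_measure nu) m).
  apply: (measurable_int m).
  exact: (@Radon_Nikodym_integrable _ _ _ (charge_of_finite_measure nu) m num).
exact: (measurableT_comp _ mRN).
Qed.

Lemma w_rho_le1 y (r : R) : r = rho m e y -> 0 <= r -> w y ^+ 2 * r <= 1.
Proof.
move=> -> r0; rewrite /w; have [->|rn0] := eqVneq (rho m e y) 0.
  by rewrite mulr0.
have rp : 0 < rho m e y by rewrite lt_def rn0.
rewrite -powR_mulrn ?powR_ge0// -powRrM -[X in _ * X]powRr1//.
by rewrite -powRD ?rn0 ?implybT// mulNr mulVf// addNr powRr0.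
Qed.

Lemma T_fun_square_integrable psi :
  square_integrable m psi -> square_integrable m (T_fun psi).
Proof.
move=> [mr mi Ipsi].
have mc := @measurable_coding B.
have mw : measurable_fun setT w.
  exact: (measurableT_comp (measurable_powR _) measurable_rho).
have mR := measurable_R_set e.
have mk : measurable_fun setT (fun x => \1_(R_set e) x * w (coding x)).
  apply: measurable_funM; first exact: measurable_indic.
  exact: (measurableT_comp mw mc).
have ReM (a : R) z : complex.Re (a%:C%C * z) = a * complex.Re z.
  by case: z => b c /=; rewrite mul0r subr0.
have ImM (a : R) z : complex.Im (a%:C%C * z) = a * complex.Im z.
  by case: z => b c /=; rewrite mul0r addr0.
split.
- under eq_fun do rewrite ReM.
  apply: measurable_funM => //.
  exact: (measurableT_comp mr mc).
- under eq_fun do rewrite ImM.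
  apply: measurable_funM => //.
  exact: (measurableT_comp mi mc).
have sqC (a : R) z : sqmod (a%:C%C * z) = a ^+ 2 * sqmod z.
  by rewrite !sqmodE ReM ImM !exprMn mulrDr.
have [num|dom] := pselect (nu `<< m); last first.
  rewrite (_ : (fun _ => _) = cst 0%E) ?integral0//.
  apply/funext => x; rewrite sqC rho_not_dominated// powR0 ?mulr0.
    by rewrite expr0n mul0r.
  by rewrite oppr_eq0 invr_eq0.
pose g y := (w y ^+ 2 * sqmod (psi y))%:E.
have g0 y : (0 <= g y)%E by rewrite lee_fin mulr_ge0 ?sqr_ge0 ?sqmod_ge0.
have mg : measurable_fun setT g.
  apply/measurable_EFinP; apply: measurable_funM; first exact: measurable_funX.
  exact: measurable_sqmod.
have -> : (\int[m]_x (sqmod (T_fun psi x))%:E = \int[nu]_y g y)%E.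
  rewrite -integral_comp_measure// [RHS]integral_mkcond; apply: eq_integral => x _.
  rewrite patchE /g sqC exprMn indicE.
  by case: (x \in R_set e); rewrite ?expr1n ?mul1r// expr0n !mul0r.
set f := Radon_Nikodym_SigmaFinite.f nu m.
have mf : measurable_fun setT f.
  exact: (measurable_int m (Radon_Nikodym_SigmaFinite.f_integrable num)).
have f0 y : (0 <= f y)%E by exact: Radon_Nikodym_SigmaFinite.f_ge0.
rewrite -(Radon_Nikodym_SigmaFinite.change_of_variables num g0)//.
apply: le_lt_trans Ipsi; apply: ae_ge0_le_integral => //.
- by move=> y _; rewrite mule_ge0.
- exact: emeasurable_funM.
- by move=> y _; rewrite lee_fin sqmod_ge0.
- by apply/measurable_EFinP; exact: measurable_sqmod.
apply: filterS (ae_eq_Radon_Nikodym_SigmaFinite num measurableT) => y /(_ I) fy _.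
have ffin : f y \is a fin_num by exact: Radon_Nikodym_SigmaFinite.f_fin_num.
have fr : fine (f y) = rho m e y by rewrite /rho -fy.
rewrite -[X in (X <= _)%E]/(g y * f y)%E -(fineK ffin) /g -EFinM lee_fin mulrAC.
apply: ler_piMl; first exact: sqmod_ge0.
by apply: w_rho_le1 => //; exact: fine_ge0.
Qed.

Lemma T_fun_l2 (psi : l2fun m) : T_fun psi \in l2_pred m.
Proof.
by apply/mem_set/T_fun_square_integrable; case: psi => f /= /set_mem.
Qed.

Definition T_op (psi : L2 m) : L2 m := l2class (L2fun (T_fun_l2 (l2rep psi))).

(* The value of [T_op] does not depend on the representative. *)
Lemma T_opE (f : l2fun m) : T_op (l2class f) = l2class (L2fun (T_fun_l2 f)).
Proof.
apply/l2classP; have /l2classP := l2repK (l2class f).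
move: (l2rep _) => h hf /=; have mR := measurable_R_set e.
have [num|dom] := pselect (nu `<< m); last first.
  apply: nearW => x; rewrite /T_fun rho_not_dominated//.
  by rewrite powR0 ?oppr_eq0 ?invr_eq0// mulr0 !mul0r.
case: hf => N [mN N0 hfN].
have nuN : nu N = 0%E by move/null_content_dominatesP : num; exact.
exists (R_set e `&` @coding B @^-1` N); split.
- exact: measurable_R_coding.
- by rewrite -comp_measureE.
move=> x /= hx; apply: contrapT => /not_andP[nR|nN]; apply: hx; rewrite /T_fun.
  by rewrite indicE memNset// !mul0r.
by congr (_ * _); apply: contrapT => ne; apply: nN; exact: hfN.
Qed.

End Operators.
Arguments T_op {R B} m e psi.

Section Measures.
Context {R : realType} (B : bratteli).
Implicit Types m : {measure set (bpath B) -> \bar R}.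

Definition non_atomic m : Prop :=
  forall A, measurable A -> (0 < m A)%E ->
    exists C, [/\ measurable C, C `<=` A & (0 < m C < m A)%E].

Definition tail_invariant m : Prop :=
  forall n (v w : B) (es fs : n.-tuple (edge B)),
    walk v es -> walk w fs -> walk_end v es = walk_end w fs ->
    m (cylinder v es) = m (cylinder w fs).

(* [p0] is the vector P_0 and [P n], for n >= 1, is the matrix P_n; [P 0] is
   never used. *)
Definition is_markov m (p0 : B -> R) (P : nat -> B -> edge B -> R) : Prop :=
  [/\ (forall v, 0 < p0 v) /\ \sum_v p0 v = 1,
      forall n, (0 < n)%N -> forall v e, (0 < P n v e) <-> src e = v,
      forall n, (0 < n)%N -> forall v, \sum_(e | src e == v) P n v e = 1 &
      forall n (v : B) (es : n.-tuple (edge B)), walk v es ->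
        m (cylinder v es) =
        (p0 v * \prod_(i < n) P i.+1 (src (tnth es i)) (tnth es i))%:E].

Definition stationary_markov m : Prop :=
  exists p0 P, is_markov m p0 P /\ forall n, (0 < n)%N -> P n = P 1.

Definition quasi_stationary_markov m : Prop :=
  exists p0 P, is_markov m p0 P /\
    forall x : bpath B, exists2 l : R, 0 < l &
      (\prod_(i < n) (P i.+2 (src (bp_edge x i)) (bp_edge x i) /
                      P i.+1 (src (bp_edge x i)) (bp_edge x i))) @[n --> \oo]
        --> l.

End Measures.

Record admissible_map (B B' : bratteli) := AdmissibleMap {
  adm :> edge B -> edge B';
  adm_bij : bijective adm;
  admP : forall e f, rng e = src f <-> rng (adm e) = src (adm f) }.

Definition alpha_bar (B B' : bratteli) (alpha : admissible_map B B')
    (x : bpath B) : bpath B' :=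
  @BPath B' (src (alpha (bp_edge x 0))) (fun i => alpha (bp_edge x i)) erefl
    (fun i => (admP alpha _ _).1 (bp_edgeP x i)).

(* Bijectivity and intertwining are only required modulo null sets. *)
Definition implements_isomorphism (R : realType) (B B' : bratteli)
    (m : {measure set (bpath B) -> \bar R})
    (m' : {measure set (bpath B') -> \bar R})
    (alpha : admissible_map B B') : Prop :=
  forall e : edge B,
  [/\ exists N N', [/\ m.-negligible N, m'.-negligible N' &
        set_bij (R_set e `\` N) (R_set (alpha e) `\` N') (alpha_bar alpha)],
      forall C, measurable C -> C `<=` R_set e ->
        (m' (alpha_bar alpha @` C) = 0%E <-> m C = 0%E) &
      {ae m, forall x, D_set e x ->
        D_set (alpha e) (alpha_bar alpha x) /\
        alpha_bar alpha (sigma e x) = sigma (alpha e) (alpha_bar alpha x)}].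

(* Main.v *)
(** An admissible map is a bijection whose inverse is admissible, so F :=
    alpha_bar is everywhere a measurable bijection commuting with the coding
    maps.  Condition (b) makes the transported measure m' \o F equivalent to m,
    hence it has a density h > 0 and W xi := sqrt h * (xi \o F) is unitary.
    Both h(sigma_e y) rho_m(y, sigma_e) and
    h(y) rho_m'(F y, sigma'_(alpha e)) are densities of m' \o F \o sigma_e with
    respect to m, so they agree almost everywhere, which is the intertwining
    relation.  If m \o sigma_e is not dominated by m, both operators vanish. *)
Require Import Defs.
From HB Require Import structures.
From mathcomp Require Import all_boot all_order all_algebra.
From mathcomp Require Import all_classical all_reals all_analysis.
From mathcomp Require Import measurable_realfun complex.

Set Implicit Arguments.
Unset Strict Implicit.
Unset Printing Implicit Defensive.
Import Order.TTheory GRing.Theory Num.Theory.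

Local Open Scope classical_set_scope.
Local Open Scope ring_scope.

(** * Densities between finite measures *)

Section Densities.
Context d (T : measurableType d) (R : realType).
Implicit Types mu nu : {finite_measure set T -> \bar R}.
Local Open Scope ereal_scope.

(** A density is real-valued and nonnegative everywhere, not just almost everywhere, so that
    products and square roots need no exceptional set. *)
Definition is_density mu (nu : set T -> \bar R) (h : T -> R) :=
  [/\ measurable_fun setT h, forall x, (0 <= h x)%R &
      forall A, measurable A -> nu A = \int[mu]_(x in A) (h x)%:E].

Lemma is_density_RN mu nu : nu `<< mu ->
  is_density mu nu (fun x => fine (Radon_Nikodym_SigmaFinite.f nu mu x)).
Proof.
move=> numu; split.
- apply: measurableT_comp => //.
  exact: (measurable_int mu (Radon_Nikodym_SigmaFinite.f_integrable numu)).
- by move=> x; apply: fine_ge0; exact: Radon_Nikodym_SigmaFinite.f_ge0.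
- move=> A mA; rewrite (Radon_Nikodym_SigmaFinite.f_integral numu mA).
  apply: eq_integral => x _.
  by rewrite fineK//; exact: Radon_Nikodym_SigmaFinite.f_fin_num.
Qed.

(** The formula for [nu] forces [nu] to be dominated by [mu]; by uniqueness [h] then agrees almost
    everywhere with the Radon-Nikodym derivative, for which the change of variables is known. *)
Lemma density_integral mu nu (h : T -> R) (g : T -> \bar R) :
    is_density mu nu h -> measurable_fun setT g -> (forall x, 0 <= g x) ->
  \int[nu]_x g x = \int[mu]_x (g x * (h x)%:E).
Proof.
move=> [mh h0 hE] mg g0.
have numu : nu `<< mu.
  apply/null_content_dominatesP => A mA A0; rewrite hE// null_set_integral//.
  exact/measurable_EFinP/measurable_funTS.
have mf : measurable_fun setT (Radon_Nikodym_SigmaFinite.f nu mu).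
  exact: (measurable_int mu (Radon_Nikodym_SigmaFinite.f_integrable numu)).
have fh : ae_eq mu setT (Radon_Nikodym_SigmaFinite.f nu mu) (EFin \o h).
  apply: integral_ae_eq => //.
  - exact: Radon_Nikodym_SigmaFinite.f_integrable.
  - exact/measurable_EFinP.
  - move=> A _ mA; rewrite -(Radon_Nikodym_SigmaFinite.f_integral numu mA).
    exact: hE.
rewrite -(Radon_Nikodym_SigmaFinite.change_of_variables numu g0)//.
apply: ae_eq_integral => //.
- exact: emeasurable_funM.
- by apply: emeasurable_funM => //; exact/measurable_EFinP.
- by apply: filterS fh => x + _ => /(_ I) ->.
Qed.

(** The zero set of a density of [nu] is null for [nu], hence for [mu], so resetting the density to
    1 there changes no integral. *)
Lemma density_gt0 mu nu : nu `<< mu -> mu `<< nu ->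
  exists2 h, is_density mu nu h & forall x, (0 < h x)%R.
Proof.
move=> numu munu; have [r [mr r0 rE]] : exists r, is_density mu nu r.
  by eexists; exact: is_density_RN numu.
have mZ : measurable [set x | r x = 0%R].
  by rewrite -[X in measurable X]setTI; exact: (mr measurableT _ (measurable_set1 0%R)).
have muZ : mu [set x | r x = 0%R] = 0.
  move/null_content_dominatesP : munu; apply => //.
  by apply: (etrans (rE _ mZ)); apply: integral0_eq => x /= ->.
pose h x := (if r x == 0 then 1 else r x)%R.
have mh : measurable_fun setT h.
  apply: measurable_fun_ifT => //; exact: measurable_fun_eqr.
have h0 x : (0 < h x)%R.
  by rewrite /h; case: ifPn => // rx; rewrite lt_def rx r0.
exists h => //; split => // [x|A mA]; first exact: ltW.
rewrite rE//; apply: ae_eq_integral => //.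
- exact/measurable_EFinP/measurable_funTS.
- exact/measurable_EFinP/measurable_funTS.
exists [set x | r x = 0%R]; split => // x /= H; apply: contrapT => rx.
by apply: H => _; rewrite /h; case: eqP.
Qed.

End Densities.

(** * Jacobian of a measurable bijection *)

Section FinitePushforward.
Context d d' (T : measurableType d) (T' : measurableType d') (R : realType).
Variables (mu : {finite_measure set T -> \bar R}) (F : {mfun T >-> T'}).

(* The library's [pushforward] is a measure but not canonically a finite one. *)
Definition fpushforward : set T' -> \bar R := pushforward mu F.

HB.instance Definition _ := Measure.copy fpushforward
  (measure_function_pushforward__canonical__measure_function_Measure
     mu (measurable_funPT F)).

Let fpushforward_fin : fin_num_fun fpushforward.
Proof.
move=> A mA; apply: fin_num_measure.
exact: measurable_funPTI.
Qed.

HB.instance Definition _ := Measure_isFinite.Build _ _ _ fpushforward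
  fpushforward_fin.

End FinitePushforward.

(** [h] is the density with respect to [mu] of the image of [mu'] under [G]. The condition on null
    sets makes the two measures equivalent, which gives a density that is positive everywhere. *)
Lemma exists_jacobian d d' (T : measurableType d) (T' : measurableType d')
    (R : realType) (mu : {finite_measure set T -> \bar R})
    (mu' : {finite_measure set T' -> \bar R}) (F : T -> T') (G : T' -> T) :
    measurable_fun setT F -> measurable_fun setT G ->
    cancel F G -> cancel G F ->
    (forall N, measurable N -> mu' N = 0%E <-> mu (F @^-1` N) = 0%E) ->
  exists h : T -> R, [/\ measurable_fun setT h, forall x, 0 < h x &
    forall g : T' -> \bar R, measurable_fun setT g -> (forall y, 0 <= g y)%E ->
      (\int[mu']_y g y = \int[mu]_x (g (F x) * (h x)%:E))%E].
Proof.
move=> mF mG FK GK null.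
have mpre A : measurable A -> measurable (G @^-1` A).
  by move=> mA; rewrite -[X in measurable X]setTI; exact: mG.
pose mixG := isMeasurableFun.Build _ _ _ _ G mG.
pose G' : {mfun T' >-> T} := HB.pack G mixG.
pose nu : {finite_measure set T -> \bar R} := fpushforward mu' G'.
have nuE A : measurable A -> nu A = 0%E <-> mu A = 0%E.
  move=> mA; rewrite -[nu A]/(mu' (G @^-1` A)) null; last exact: mpre.
  by rewrite -comp_preimage (_ : _ \o _ = id)//; apply/funext => x /=; rewrite FK.
have [|| h hP h_gt0] := @density_gt0 _ _ _ mu nu.
- by apply/null_content_dominatesP => A mA /(nuE _ mA).
- by apply/null_content_dominatesP => A mA /(nuE _ mA).
have [mh _ _] := hP; exists h; split => // g mg g0.
rewrite -(density_integral hP (g := g \o F)); first last.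
- by move=> x; exact: g0.
- exact: (measurableT_comp mg mF).
rewrite (@ge0_integral_pushforward _ _ _ _ _ _ mG mu')//.
- by apply: eq_integral => y _ /=; rewrite GK.
- exact: (measurableT_comp mg mF).
- by move=> x _; exact: g0.
Qed.

(** * Complex-valued functions and the inner product of classes *)

Section ComplexParts.
Context (R : realType).
Implicit Types (a : R) (z : R[i]).

Lemma ReM_real a z : complex.Re (a%:C%C * z) = a * complex.Re z.
Proof. by case: z => b c /=; rewrite mul0r subr0. Qed.

Lemma ImM_real a z : complex.Im (a%:C%C * z) = a * complex.Im z.
Proof. by case: z => b c /=; rewrite mul0r addr0. Qed.

Lemma conjcM_real a z : conjc (a%:C%C * z) = a%:C%C * conjc z.
Proof.
case: z => b c; apply/eqP; rewrite eq_complex /=.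
by rewrite !mul0r !subr0 !addr0 mulrN !eqxx.
Qed.

Lemma sqmodM_real a z : sqmod (a%:C%C * z) = a ^+ 2 * sqmod z.
Proof. by rewrite !sqmodE ReM_real ImM_real !exprMn mulrDr. Qed.

End ComplexParts.

Section Inner.
Context d (T : measurableType d) (R : realType) (mu : {measure set T -> \bar R}).

Lemma l2fun_measurable (f : l2fun mu) :
  measurable_fun setT (fun x => complex.Re (f x)) /\
  measurable_fun setT (fun x => complex.Im (f x)).
Proof. by case: f => f /= /set_mem[]. Qed.

Lemma measurable_inner (f g : l2fun mu) :
  measurable_fun setT (fun x => complex.Re (f x * conjc (g x))) /\
  measurable_fun setT (fun x => complex.Im (f x * conjc (g x))).
Proof.
have [fr fi] := l2fun_measurable f; have [gr gi] := l2fun_measurable g.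
split.
  rewrite (_ : (fun _ => _) = (fun x => complex.Re (f x) * complex.Re (g x) +
     complex.Im (f x) * complex.Im (g x))); last first.
    apply/funext => x; case: (f x) (g x) => [a b] [a' b'] /=.
    by rewrite mulrN opprK.
  by apply: measurable_funD; exact: measurable_funM.
rewrite (_ : (fun _ => _) = (fun x => complex.Im (f x) * complex.Re (g x) -
   complex.Re (f x) * complex.Im (g x))); last first.
  apply/funext => x; case: (f x) (g x) => [a b] [a' b'] /=.
  by rewrite mulrN addrC.
by apply: measurable_funB; exact: measurable_funM.
Qed.

(** Changing representatives alters the integrand only on a null set, so the inner product can be
    computed from any functions in the classes. *)
Lemma l2innerE (f g : l2fun mu) : l2inner (l2class f) (l2class g) =
  Complex (\int[mu]_x complex.Re (f x * conjc (g x)))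
          (\int[mu]_x complex.Im (f x * conjc (g x))).
Proof.
have /l2classP ff := l2repK (l2class f); have /l2classP gg := l2repK (l2class g).
have [fgr fgi] := measurable_inner f g.
have [uvr uvi] := measurable_inner (l2rep (l2class f)) (l2rep (l2class g)).
rewrite /l2inner; congr Complex; rewrite /Rintegral; congr fine;
  apply: ae_eq_integral => //; try exact/measurable_EFinP;
  by apply: filterS2 ff gg => x -> ->.
Qed.

End Inner.

(** * The unitary given by weighted composition *)

Section WeightedComposition.
Context d d' (T : measurableType d) (T' : measurableType d') (R : realType).
Variables (mu : {measure set T -> \bar R}) (mu' : {measure set T' -> \bar R}).
Variables (F : T -> T') (G : T' -> T) (h : T -> R).
Hypotheses (mF : measurable_fun setT F) (mG : measurable_fun setT G).
Hypothesis FK : cancel F G.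
Hypotheses (mh : measurable_fun setT h) (h_gt0 : forall x, 0 < h x).
Hypothesis change_of_measure : forall g : T' -> \bar R,
  measurable_fun setT g -> (forall y, 0 <= g y)%E ->
  (\int[mu']_y g y = \int[mu]_x (g (F x) * (h x)%:E))%E.

(** Multiplication by [h x > 0] commutes with taking positive and negative parts, so the formula
    extends to signed functions without an integrability assumption. *)
Lemma change_of_measure_signed (g : T' -> R) : measurable_fun setT g ->
  (\int[mu']_y (g y)%:E = \int[mu]_x (h x * g (F x))%:E)%E.
Proof.
move=> mg; have mg' : measurable_fun setT (EFin \o g) by exact/measurable_EFinP.
rewrite integralE [RHS]integralE; congr (_ - _)%E.
- rewrite change_of_measure//; last exact: measurable_funepos.
  apply: eq_integral => x _; rewrite !funeposE EFinM muleC maxe_pMr ?mule0//.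
  by rewrite lee_fin ltW.
- rewrite change_of_measure//; last exact: measurable_funeneg.
  apply: eq_integral => x _; rewrite !funenegE EFinM muleC -muleN.
  by rewrite maxe_pMr ?mule0// lee_fin ltW.
Qed.

Definition wcomp (f : T' -> R[i]) (x : T) : R[i] :=
  (Num.sqrt (h x))%:C%C * f (F x).

Let measurable_sqrth : measurable_fun setT (fun x => Num.sqrt (h x)).
Proof.
under eq_fun do rewrite -powR12_sqrt ?ltW//.
exact: (measurableT_comp (measurable_powR _)).
Qed.

Lemma measurable_wcomp (f : T' -> R[i]) :
    measurable_fun setT (fun y => complex.Re (f y)) ->
    measurable_fun setT (fun y => complex.Im (f y)) ->
  measurable_fun setT (fun x => complex.Re (wcomp f x)) /\
  measurable_fun setT (fun x => complex.Im (wcomp f x)).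
Proof.
move=> fr fi; split.
- under eq_fun do rewrite ReM_real.
  by apply: measurable_funM => //; exact: (measurableT_comp fr).
- under eq_fun do rewrite ImM_real.
  by apply: measurable_funM => //; exact: (measurableT_comp fi).
Qed.

Lemma integral_sqmod_wcomp (f : T' -> R[i]) :
    measurable_fun setT (fun y => complex.Re (f y)) ->
    measurable_fun setT (fun y => complex.Im (f y)) ->
  (\int[mu]_x (sqmod (wcomp f x))%:E = \int[mu']_y (sqmod (f y))%:E)%E.
Proof.
move=> fr fi; rewrite change_of_measure.
- apply: eq_integral => x _.
  by rewrite sqmodM_real sqr_sqrtr ?ltW// EFinM muleC.
- by apply/measurable_EFinP; exact: measurable_sqmod.
- by move=> y; rewrite lee_fin sqmod_ge0.
Qed.

Lemma wcomp_l2 (f : l2fun mu') : wcomp f \in l2_pred mu.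
Proof.
have [fr fi] := l2fun_measurable f; have [wr wi] := measurable_wcomp fr fi.
apply/mem_set; split => //; rewrite integral_sqmod_wcomp//.
by case: f {fr fi wr wi} => f /= /set_mem[].
Qed.

(** The explicit preimage divides by the weight and composes with [G]. It is square integrable
    because [wcomp] preserves the integral of the squared modulus. *)
Lemma wcomp_surj (v : l2fun mu) : exists f : l2fun mu', wcomp f =1 v.
Proof.
have [vr vi] := l2fun_measurable v.
pose f y := ((Num.sqrt (h (G y)))^-1)%:C%C * v (G y).
have fv : wcomp f =1 v.
  move=> x; rewrite /wcomp /f FK mulrA -rmorphM /= divff ?mul1r//.
  by rewrite gt_eqF// sqrtr_gt0.
have mi : measurable_fun setT (fun y => (Num.sqrt (h (G y)))^-1).
  under eq_fun do rewrite -powR12_sqrt ?ltW// -powRN.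
  apply: (measurableT_comp (measurable_powR _)).
  exact: measurableT_comp.
have fr : measurable_fun setT (fun y => complex.Re (f y)).
  under eq_fun do rewrite ReM_real.
  by apply: measurable_funM => //; exact: (measurableT_comp vr).
have fi : measurable_fun setT (fun y => complex.Im (f y)).
  under eq_fun do rewrite ImM_real.
  by apply: measurable_funM => //; exact: (measurableT_comp vi).
have fl2 : f \in l2_pred mu'.
  apply/mem_set; split => //; rewrite -integral_sqmod_wcomp//.
  under eq_integral do rewrite fv.
  by case: v {vr vi f fv fr fi} => v /= /set_mem[].
by exists (L2fun fl2).
Qed.

Definition Wop (u : L2 mu') : L2 mu := l2class (L2fun (wcomp_l2 (l2rep u))).

Hypothesis preimage_null : forall N, measurable N -> mu' N = 0%E ->
  mu (F @^-1` N) = 0%E.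

(** Two representatives differ on a null set of [mu'], whose preimage under [F] is null for [mu]. *)
Lemma WopE (f : l2fun mu') : Wop (l2class f) = l2class (L2fun (wcomp_l2 f)).
Proof.
apply/l2classP; have /l2classP[N [mN N0 NP]] := l2repK (l2class f).
exists (F @^-1` N); split; [|exact: preimage_null|].
  by rewrite -[X in measurable X]setTI; exact: mF.
by move=> x /= H; apply: NP => /= E; apply: H; rewrite /wcomp E.
Qed.

Lemma Wop_linear : linear Wop.
Proof.
move=> a u v; rewrite -(l2repK u) -(l2repK v) -[a *: l2class _]l2classZ -l2classD.
rewrite !WopE -[a *: l2class _]l2classZ -l2classD; apply/l2classP.
apply: nearW => x /=; rewrite /wcomp.
rewrite -[LHS]/(_ * (a * _ + _)) -[RHS]/(a * (_ * _) + (_ * _)).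
by rewrite mulrDr mulrCA.
Qed.

Lemma Wop_inner (u v : L2 mu') : l2inner (Wop u) (Wop v) = l2inner u v.
Proof.
rewrite -(l2repK u) -(l2repK v); move: (l2rep u) (l2rep v) => f g.
rewrite !WopE !l2innerE; have [mr mi] := measurable_inner f g.
(* The two real weights multiply to [h x], exactly the Jacobian factor of the change of measure. *)
have E x : wcomp f x * conjc (wcomp g x) = (h x)%:C%C * (f (F x) * conjc (g (F x))).
  rewrite /wcomp conjcM_real mulrACA; congr (_ * _).
  by rewrite -rmorphM -expr2 sqr_sqrtr// ltW.
congr Complex; rewrite /Rintegral; congr fine; rewrite change_of_measure_signed//;
  by apply: eq_integral => x _; rewrite E ?ReM_real ?ImM_real.
Qed.

Lemma Wop_unitary : exists W : {linear L2 mu' -> L2 mu},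
  unitary_map W /\ forall f, W (l2class f) = l2class (L2fun (wcomp_l2 f)).
Proof.
pose W : {linear L2 mu' -> L2 mu} :=
  HB.pack Wop (GRing.isLinear.Build _ _ _ _ Wop Wop_linear).
exists W; split; last exact: WopE.
split; first exact: Wop_inner.
move=> v; have [f fv] := wcomp_surj (l2rep v).
exists (l2class f); apply: etrans (WopE f) _; rewrite -[RHS]l2repK.
by apply/l2classP; apply: nearW => x; exact: fv.
Qed.

End WeightedComposition.

(** * Measurability and inversion of the path maps *)

Lemma measurable_sigma (B : bratteli) (e : edge B) : measurable_fun setT (sigma e).
Proof.
apply: (@local_measurable _ _ _ 0) => x y [//|n] H i iln; rewrite addn0 in H.
(* The paths share at least their first edge, which decides membership in [D_set e]; the two mixed
   cases are therefore contradictory. *)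
rewrite /sigma; case: pselect => Dy; case: pselect => Dx /=; last exact: H.
- by case: i iln => //= i iln; apply: H; exact: ltnW.
- by case: Dx; rewrite /D_set /= -H.
- by case: Dy; rewrite /D_set /= H.
Qed.

(** The compatibility condition on [alpha] is an equivalence, so it passes to the inverse
    bijection. *)
Lemma admissible_inverse (B B' : bratteli) (alpha : admissible_map B B') :
  exists beta : admissible_map B' B, cancel alpha beta /\ cancel beta alpha.
Proof.
have [b aK bK] := adm_bij alpha.
have bP e f : rng e = src f <-> rng (b e) = src (b f).
  by rewrite (admP alpha) !bK.
by exists (AdmissibleMap (Bijective bK aK) bP).
Qed.

Section AlphaBar.
Variables (B B' : bratteli) (alpha : admissible_map B B').

Lemma measurable_alpha_bar : measurable_fun setT (alpha_bar alpha).
Proof.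
apply: (@local_measurable _ _ _ 0) => x y n H i iln /=.
by rewrite H// addn0.
Qed.

Lemma alpha_barK (beta : admissible_map B' B) :
  cancel alpha beta -> cancel (alpha_bar alpha) (alpha_bar beta).
Proof. by move=> aK x; apply: bpath_eq; apply/funext => i /=; rewrite aK. Qed.

Lemma coding_alpha_bar x : coding (alpha_bar alpha x) = alpha_bar alpha (coding x).
Proof. exact: bpath_eq. Qed.

Lemma R_set_alpha_bar e x : R_set (alpha e) (alpha_bar alpha x) = R_set e x.
Proof.
by apply/propext; split => [/(bij_inj (adm_bij alpha))|]; rewrite /R_set /= => ->.
Qed.

End AlphaBar.

(** * The densities [rho] and the intertwining relation *)

(** [rho] is controlled only almost everywhere; [r] is a version of it that is nonnegative
    everywhere. *)
Lemma rho_density (R : realType) (B : bratteli)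
    (m : {finite_measure set (bpath B) -> \bar R}) (e : edge B) :
    comp_measure m e `<< m ->
  exists2 r, is_density m (comp_measure m e) r &
    {ae m, forall y, rho m e y = r y}.
Proof.
move=> num; eexists; first exact: is_density_RN num.
apply: filterS (ae_eq_Radon_Nikodym_SigmaFinite num measurableT) => y /(_ I) fy.
by rewrite /rho -fy.
Qed.

(* Zero denominators are allowed: x / 0 = 0 on both sides. *)
Lemma cross_div (K : fieldType) (x y p q : K) :
  x != 0 -> y != 0 -> x * p = y * q -> x / q = p^-1 * y.
Proof.
move=> x0 y0 E; have [p0|p0] := eqVneq p 0.
  move/eqP: E; rewrite p0 mulr0 eq_sym mulf_eq0 (negPf y0) /= => /eqP ->.
  by rewrite invr0 mulr0 mul0r.
have q0 : q != 0.
  apply: contra_neq p0 => q0; apply/eqP; move/eqP: E.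
  by rewrite q0 mulr0 mulf_eq0 (negPf x0).
by apply/eqP; rewrite [_^-1 * _]mulrC eqr_div// E.
Qed.

Section Intertwining.
Context (R : realType) (B B' : bratteli).
Variables (m : {finite_measure set (bpath B) -> \bar R}).
Variables (m' : {finite_measure set (bpath B') -> \bar R}).
Variables (alpha : admissible_map B B') (e : edge B) (h : bpath B -> R).
Let F := alpha_bar alpha.
Hypotheses (mh : measurable_fun setT h) (h_gt0 : forall x, 0 < h x).
Hypothesis change_of_measure : forall g : bpath B' -> \bar R,
  measurable_fun setT g -> (forall y, 0 <= g y)%E ->
  (\int[m']_y g y = \int[m]_x (g (F x) * (h x)%:E))%E.
Hypothesis alpha_bar_null : forall N, measurable N ->
  (m' N = 0%E <-> m (F @^-1` N) = 0%E).

Let measurable_preimage_F N : measurable N -> measurable (F @^-1` N).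
Proof.
by move=> mN; rewrite -[X in measurable X]setTI; exact: measurable_alpha_bar.
Qed.

(** [F] respects the sets [R_set], the coding maps and null sets in both directions, and these
    determine the null sets of [comp_measure]. *)
Lemma comp_measure_dominated_alpha :
  comp_measure m e `<< m <-> comp_measure m' (alpha e) `<< m'.
Proof.
have preR N : F @^-1` (R_set (alpha e) `&` @coding B' @^-1` N) =
    R_set e `&` @coding B @^-1` (F @^-1` N).
  by rewrite /F preimage_setI; congr (_ `&` _); apply/funext => x;
    rewrite /preimage /mkset ?R_set_alpha_bar ?coding_alpha_bar.
have [beta [aK bK]] := admissible_inverse alpha.
have mG := @measurable_alpha_bar _ _ beta.
(* Every set is an [F]-preimage, which lets the converse direction reuse the same identity. *)
have FG N : F @^-1` (alpha_bar beta @^-1` N) = N.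
  by apply/funext => x; rewrite /preimage /mkset /F alpha_barK.
split=> /null_content_dominatesP dom; apply/null_content_dominatesP => N mN N0.
- apply: (etrans (comp_measureE _ _ _)).
  apply/alpha_bar_null; first exact: measurable_R_coding.
  rewrite preR -comp_measureE; apply: dom; first exact: measurable_preimage_F.
  exact/alpha_bar_null.
- have mGN : measurable (alpha_bar beta @^-1` N).
    by rewrite -[X in measurable X]setTI; exact: mG.
  apply: (etrans (comp_measureE _ _ _)).
  rewrite -(FG N) -preR; apply/alpha_bar_null; first exact: measurable_R_coding.
  rewrite -comp_measureE; apply: dom => //.
  by apply/alpha_bar_null => //; rewrite FG.
Qed.

(** Over every measurable [C] both sides have the same integral: that of [h] over the points of
    [R_set e] whose coding lies in [C], which is the value at [C] of [m' \o F \o sigma_e]. *)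
Lemma density_chain_rule r r' :
    is_density m (comp_measure m e) r ->
    is_density m' (comp_measure m' (alpha e)) r' ->
  {ae m, forall y, h (sigma e y) * r y = h y * r' (F y)}.
Proof.
move=> rP rP'; have [mr r0 _] := rP; have [mr' r0' rE'] := rP'.
have [beta [aK bK]] := admissible_inverse alpha.
have mF : measurable_fun setT F := @measurable_alpha_bar _ _ alpha.
have mG := @measurable_alpha_bar _ _ beta.
have mRe := measurable_R_set e; have mRe' := measurable_R_set (alpha e).
have mhs : measurable_fun setT (fun y => h (sigma e y)).
  exact: (measurableT_comp mh (@measurable_sigma _ e)).
have mk1 : measurable_fun setT (fun y => h (sigma e y) * r y).
  exact: measurable_funM.
have mk2 : measurable_fun setT (fun y => h y * r' (F y)).
  by apply: measurable_funM => //; exact: (measurableT_comp mr' mF).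
have k10 y : 0 <= h (sigma e y) * r y by rewrite mulr_ge0// ltW.
have k20 y : 0 <= h y * r' (F y) by rewrite mulr_ge0// ltW.
have mI C : measurable C -> measurable_fun setT (\1_C : bpath B -> R).
  by move=> mC; exact: measurable_indic.
have I1 C : measurable C ->
    (\int[m]_(y in C) (h (sigma e y) * r y)%:E =
     \int[m]_(x in R_set e) (\1_C (coding x) * h x)%:E)%E.
  move=> mC; rewrite integral_mkcond.
  transitivity (\int[m]_y ((\1_C y * h (sigma e y))%:E * (r y)%:E))%E.
    apply: eq_integral => y _; rewrite epatch_indic /= -!EFinM.
    by rewrite mulrC mulrA.
  rewrite -(density_integral rP); first last.
  - by move=> y; rewrite lee_fin mulr_ge0// ltW.
  - by apply/measurable_EFinP; apply: measurable_funM => //; exact: mI.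
  rewrite -integral_comp_measure; first last.
  - by move=> y; rewrite lee_fin mulr_ge0// ltW.
  - by apply/measurable_EFinP; apply: measurable_funM => //; exact: mI.
  by apply: eq_integral => x /set_mem Rx; rewrite codingK.
have I2 C : measurable C ->
    (\int[m]_(y in C) (h y * r' (F y))%:E =
     \int[m]_(x in R_set e) (\1_C (coding x) * h x)%:E)%E.
  move=> mC; have mGC : measurable_fun setT (fun y => \1_C (alpha_bar beta y) : R).
    exact: (measurableT_comp (mI _ mC) mG).
  rewrite integral_mkcond.
  (* Writing [y] as [alpha_bar beta (F y)] turns the integrand into a function of [F y] times [h y],
     as the change of measure requires. *)
  transitivity (\int[m]_x ((\1_C (alpha_bar beta (F x)) * r' (F x))%:E * (h x)%:E))%E.
    apply: eq_integral => y _; rewrite epatch_indic /= alpha_barK// -!EFinM.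
    by rewrite mulrC (mulrC (h y)) mulrA.
  rewrite -(change_of_measure (g := fun y => (\1_C (alpha_bar beta y) * r' y)%:E));
    first last.
  - by move=> y; rewrite lee_fin mulr_ge0.
  - by apply/measurable_EFinP; exact: measurable_funM.
  under eq_integral do rewrite EFinM.
  rewrite -(density_integral rP' (g := fun y => (\1_C (alpha_bar beta y))%:E));
    first last.
  - by move=> y; rewrite lee_fin.
  - exact/measurable_EFinP.
  rewrite -integral_comp_measure//; last exact/measurable_EFinP.
  rewrite integral_mkcond change_of_measure; first last.
  - by move=> y; rewrite patchE; case: ifP => // _; rewrite lee_fin.
  - apply/(measurable_restrictT _ mRe'); apply: measurable_funTS.
    by apply/measurable_EFinP; exact: (measurableT_comp mGC (@measurable_coding B')).
  rewrite [RHS]integral_mkcond; apply: eq_integral => x _; rewrite !patchE.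
  have -> : (F x \in R_set (alpha e)) = (x \in R_set e).
    by rewrite /in_mem /= /in_set /= /F R_set_alpha_bar.
  case: ifP => _; last by rewrite mul0e.
  by rewrite /F coding_alpha_bar alpha_barK.
have k1k2 : ae_eq m setT (fun y => (h y * r' (F y))%:E)
    (fun y => (h (sigma e y) * r y)%:E).
  apply: integral_ae_eq => //.
  - apply/integrableP; split; first exact/measurable_EFinP.
    under eq_integral do rewrite gee0_abs ?lee_fin//.
    (* Integrability: with [C] the whole space the integral is at most that of [h], which is the
       finite total mass of [m']. *)
    rewrite I2//; apply: (@le_lt_trans _ _ (\int[m]_x (h x)%:E)%E).
      under eq_integral do rewrite indicT mul1r.
      apply: ge0_subset_integral => //; last by move=> x _; rewrite lee_fin ltW.
      exact/measurable_EFinP.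
    under eq_integral do rewrite -[(h _)%:E]mul1e.
    rewrite -(change_of_measure (g := cst 1%E))// integral_cst// mul1e.
    by rewrite ltey_eq fin_num_measure.
  - exact/measurable_EFinP.
  - by move=> E _ mE; rewrite I1// I2.
by apply: filterS k1k2 => y /(_ I) [->].
Qed.

(** On [R_set e] one has [x = sigma e (coding x)], and the claim is the square root of the chain
    rule at [coding x]; off [R_set e] both sides vanish. *)
Lemma T_fun_wcomp (f : bpath B' -> R[i]) :
  {ae m, forall x, wcomp F h (T_fun m' (alpha e) f) x = T_fun m e (wcomp F h f) x}.
Proof.
have [dom|ndom] := pselect (comp_measure m e `<< m); last first.
  have ndom' : ~ (comp_measure m' (alpha e) `<< m').
    by move=> dom'; exact/ndom/comp_measure_dominated_alpha.
  (* Without domination both densities are the default 0, and 0 to the power -1/2 is 0 by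
     convention. *)
  apply: nearW => x; rewrite /wcomp /T_fun !rho_not_dominated//.
  by rewrite powR0 ?oppr_eq0 ?invr_eq0// !mulr0 !mul0r mulr0.
have dom' := comp_measure_dominated_alpha.1 dom.
have [r rP rhor] := rho_density dom; have [r' rP' rhor'] := rho_density dom'.
have rhor'F : {ae m, forall y, rho m' (alpha e) (F y) = r' (F y)}.
  have [N [mN N0 NP]] := rhor'.
  exists (F @^-1` N); split; [exact: measurable_preimage_F|exact/alpha_bar_null|].
  by move=> x /= H; exact: NP.
have chain : {ae m, forall y,
    [/\ h (sigma e y) * rho m e y = h y * rho m' (alpha e) (F y),
        0 <= rho m e y & 0 <= rho m' (alpha e) (F y)]}.
  have [_ r0 _] := rP; have [_ r0' _] := rP'.
  apply: filterS3 rhor rhor'F (density_chain_rule rP rP') => y -> -> ->.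
  by split.
have [N [mN N0 NP]] := chain.
(* The chain rule is used at [coding x], so its exceptional set is pulled back by the coding map;
   the result is null because [m \o sigma_e] is dominated by [m]. *)
exists (R_set e `&` @coding B @^-1` N); split.
- exact: measurable_R_coding.
- by rewrite -comp_measureE; move/null_content_dominatesP : dom; apply.
move=> x /= nx; apply: contrapT => /not_andP xN; apply: nx.
have [Rx|nRx] := pselect (R_set e x); last first.
  by rewrite /wcomp /T_fun !indicE !memNset ?R_set_alpha_bar// !mul0r mulr0.
have [E p0 p0'] : [/\ h (sigma e (coding x)) * rho m e (coding x) =
    h (coding x) * rho m' (alpha e) (F (coding x)),
    0 <= rho m e (coding x) & 0 <= rho m' (alpha e) (F (coding x))].
  by case: xN => // nN; apply: contrapT => nc; apply: nN; exact: NP.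
rewrite /wcomp /T_fun !indicE !mem_set ?R_set_alpha_bar// !mul1r /F coding_alpha_bar.
rewrite !mulrA -!rmorphM; congr ((_)%:C%C * _).
rewrite codingK// in E; have hx := h_gt0 x; have hc := h_gt0 (coding x).
rewrite -!powR12_sqrt ?ltW// !powRN.
have {}E : h x `^ 2^-1 * rho m e (coding x) `^ 2^-1 =
    h (coding x) `^ 2^-1 * rho m' (alpha e) (F (coding x)) `^ 2^-1.
  by rewrite -!powRM ?E// ltW.
by apply: (cross_div _ _ E); rewrite gt_eqF// powR_gt0.
Qed.

End Intertwining.

(** * Null sets under [alpha_bar] and the unitary equivalence *)

Lemma null_R_set (R : realType) (B : bratteli)
    (m : {measure set (bpath B) -> \bar R}) (N : set (bpath B)) :
  measurable N ->
  m N = 0%E <-> forall e : edge B, m (N `&` R_set e) = 0%E.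
Proof.
move=> mN; have mNR e : measurable (N `&` R_set e).
  by apply: measurableI => //; exact: measurable_R_set.
split=> [N0 e|N0].
  by apply: (subset_measure0 (mNR e) mN) => //; exact: subIsetl.
apply: measure_negligible => //.
have : {ae m, forall x, forall e : edge B, ~ (N `&` R_set e) x}.
  (* There are finitely many edges, so the almost-everywhere statements can be intersected. *)
  apply: filter_forall => e; exists (N `&` R_set e); split => // x.
  exact: contrapT.
by apply: negligibleS => x Nx /(_ (bp_edge x 0)); apply.
Qed.

(** Condition (b) compares null sets inside a single [R_set e]. Since [alpha_bar] is onto, the image
    of a preimage is the set itself, and the pieces are glued over all edges. *)
Lemma alpha_bar_null (R : realType) (B B' : bratteli)
    (m : {measure set (bpath B) -> \bar R})
    (m' : {measure set (bpath B') -> \bar R}) (alpha : admissible_map B B') :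
  implements_isomorphism m m' alpha ->
  forall N, measurable N -> m' N = 0%E <-> m (alpha_bar alpha @^-1` N) = 0%E.
Proof.
move=> iso N mN; have [beta [aK bK]] := admissible_inverse alpha.
have mFN : measurable (alpha_bar alpha @^-1` N).
  by rewrite -[X in measurable X]setTI; exact: measurable_alpha_bar.
have step e : m' (N `&` R_set (alpha e)) = 0%E <->
    m (alpha_bar alpha @^-1` N `&` R_set e) = 0%E.
  have [_ /(_ (alpha_bar alpha @^-1` N `&` R_set e)) H _] := iso e.
  rewrite -H; last exact: subIsetr; last first.
    by apply: measurableI => //; exact: measurable_R_set.
  suff -> : alpha_bar alpha @` (alpha_bar alpha @^-1` N `&` R_set e) =
      N `&` R_set (alpha e) by [].
  apply/seteqP; split => [_ [x [Nx Rx] <-]|y [Ny Ry]].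
    by split => //; rewrite R_set_alpha_bar.
  have yE : alpha_bar alpha (alpha_bar beta y) = y by exact: alpha_barK.
  exists (alpha_bar beta y) => //; split; first by rewrite /preimage /= yE.
  by rewrite -(R_set_alpha_bar alpha) yE.
rewrite !null_R_set//; split => [H e|H e']; first exact/step.
by rewrite -(bK e'); exact/step.
Qed.

Theorem theorem4p10 (R : realType) (B B' : bratteli)
    (hB : cantor_like (bpath B)) (hB' : cantor_like (bpath B'))
    (m : probability (bpath B) R) (m' : probability (bpath B') R)
    (hna : non_atomic m) (hna' : non_atomic m')
    (hm : tail_invariant m \/ stationary_markov m \/ quasi_stationary_markov m)
    (hm' : tail_invariant m' \/ stationary_markov m' \/
           quasi_stationary_markov m')
    (alpha : admissible_map B B')
    (hiso : implements_isomorphism m m' alpha) :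
  exists W : {linear L2 m' -> L2 m},
    unitary_map W /\
    forall (e : edge B) (xi : L2 m'),
      W (T_op m' (alpha e) xi) = T_op m e (W xi).
Proof.
have null := alpha_bar_null hiso.
have [beta [aK bK]] := admissible_inverse alpha.
have mF := @measurable_alpha_bar _ _ alpha.
have mG := @measurable_alpha_bar _ _ beta.
have FK := alpha_barK aK; have GK := alpha_barK bK.
have [h [mh h_gt0 change]] := exists_jacobian mF mG FK GK null.
have null1 N (mN : measurable N) := (null N mN).1.
have [W [WU WE]] := Wop_unitary mF mG FK mh h_gt0 change null1.
(* On representatives the intertwining relation becomes an almost-everywhere identity of
   functions. *)
exists W; split => // e xi; rewrite -(l2repK xi) T_opE !WE T_opE.
by apply/l2classP; exact: T_fun_wcomp.
Qed.
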